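(* Let $\ell\ge 0$ be an integer, and let $\bar P^{(\ell)}_{e,T}$ and $\bar P^{(\ell)}_{e,P}$ denote the asymptotic (blocklength $n\to\infty$) expected decoding error probabilities after $\ell$ iterations of the same message-passing decoder for the $(d_v,d_c)$-regular LDPC ensemble, over the same channel with noise parameter $\varepsilon$ and with the same missing-connection probability $\alpha$, in the case of transiently missing connections and of permanently missing connections, respectively. Then for any (arbitrarily small) $\delta>0$ and any $\sigma>0$, $$\Pr\Big[\,\big|\bar P^{(\ell)}_{e,T}-\bar P^{(\ell)}_{e,P}\big|\ge\sigma\Big]\le\delta .$$
   Context: Ensemble. The $(d_v,d_c)$-regular LDPC ensemble $G^n$ of length $n$ ($d_v,d_c\ge2$, $d_c\mid n d_v$) is the random bipartite (Tanner) multigraph with $n$ variable nodes having $d_v$ sockets each and $n d_v/d_c$ check nodes having $d_c$ sockets each, in which the $n d_v$ variable sockets are matched to the $n d_v$ check sockets by a uniformly random permutation. Code symbols take values in $\{\pm1\}$. Channel. The all-one codeword is transmitted over a binary memoryless symmetric channel with noise parameter $\varepsilon$ (for example a BSC with outputs in $\{\pm 1\}$ or a BEC with outputs in $\{\pm1,?\}$), so that the channel values received at the $n$ variable nodes are i.i.d. Message-passing decoder. In iteration $0$ each variable node forms, for each of its edges, a message that is a function of its received channel value. In each iteration $t\ge 1$, the variable-to-check messages formed in iteration $t-1$ are sent along the edges; each check node computes for each of its edges a message that is a fixed function of the messages received on its other $d_c-1$ edges and sends it; then each variable node computes for each of its edges a message that is a fixed function of its channel value and the check-to-variable messages received on its other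 $d_v-1$ edges. Whenever a connection (edge) is missing, any message sent along it, in either direction, is received as the erasure symbol ''$?$'', which belongs to the message alphabet. Missing connections. Let $\alpha\in[0,1]$. Permanently missing: before decoding starts, each edge is removed independently with probability $\alpha$ and stays missing in all iterations. Transiently missing: in each decoding iteration, each edge is missing independently with probability $\alpha$, independently over edges and iterations. Missing-connection randomness is independent of the graph and the channel. Error probability. The value held on an edge at the end of iteration $\ell$ is the message computed for this edge by its variable node in iteration $\ell$; it is incorrect if it does not represent the transmitted symbol $+1$ (an erasure counts as incorrect). $P_e^{(\ell)}(g,\varepsilon,\alpha)$ denotes the fraction of the $n d_v$ edges of $g\in G^n$ holding incorrect values at the end of iteration $\ell$, and $$\bar P_e^{(\ell)}=\lim_{n\to\infty}E\big[P_e^{(\ell)}(g,\varepsilon,\alpha)\big],$$ the expectation being over the choice of code, the channel noise realization and the missing-connection realization. $\bar P^{(\ell)}_{e,T}$ and $\bar P^{(\ell)}_{e,P}$ are this quantity for transiently and permanently missing connections. Since these are deterministic numbers, the probability in the claim is that of a deterministic event (it equals $0$ or $1$). *)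

(* Defs.v *)
From HB Require Import structures.
From mathcomp Require Import all_boot all_order all_algebra.
From mathcomp Require Import all_classical all_reals all_analysis.
Set Implicit Arguments.
Unset Strict Implicit.
Unset Printing Implicit Defensive.
Import Order.TTheory GRing.Theory Num.Theory.
Import numFieldNormedType.Exports.
Local Open Scope classical_set_scope.
Local Open Scope ring_scope.

Section iid.
Context d (T : measurableType d).

Definition cons_pair n (p : T * n.-tuple T) : n.+1.-tuple T :=
  [tuple of p.1 :: p.2].

Lemma measurable_cons_pair n : measurable_fun setT (@cons_pair n).
Proof. exact: measurable_cons. Qed.

HB.instance Definition _ n :=
  isMeasurableFun.Build _ _ _ _ (@cons_pair n) (@measurable_cons_pair n).

Context (R : realType).

(* The n-fold product P (x) ... (x) P, i.e. the law of n i.i.d. variables of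
   law P; see iidE. *)
Fixpoint iid (P : probability T R) n : probability (n.-tuple T) R :=
  match n with
  | 0 => \d_ [tuple]
  | n'.+1 => distribution (P \x iid P n')%E (@cons_pair n')
  end.

Lemma iidE (P : probability T R) n (B : 'I_n -> set T) :
  (forall i, measurable (B i)) ->
  iid P n [set y | forall i, B i (tnth y i)] = (\prod_(i < n) P (B i))%E.
Proof.
elim: n B => [|n IH] B mB.
  by rewrite big_ord0/= diracE mem_set// => -[].
have mI : measurable [set y : n.-tuple T | forall i, B (lift ord0 i) (tnth y i)].
  rewrite (_ : [set _ | _] = \big[setI/setT]_(i < n)
      ((@tnth n T ^~ i) @^-1` B (lift ord0 i))); last first.
    apply/seteqP; split => y /=; rewrite -bigcap_seq => h i /=.
      by move=> _; exact: h.
    by apply: h; exact: mem_index_enum.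
  apply: bigsetI_measurable => i _; rewrite -[X in measurable X]setTI.
  exact: measurable_tnth.
rewrite big_ord_recl -IH// -product_measure1E//=.
rewrite /distribution /pushforward; congr (_ _).
apply/seteqP; split=> -[x y]/=.
  by move=> h; split=> [|i]; [have := h ord0|have := h (lift ord0 i); rewrite tnthS].
by move=> [h0 h] i; case: (unliftP ord0 i) => [j|] ->; rewrite ?tnthS//; exact: h.
Qed.

End iid.

(* Binary-input memoryless symmetric channel with output space Y.  The input
   (-1)^b is encoded by b, so that law false is the output law given that +1 is
   sent. *)
Record bms_channel d (Y : measurableType d) (R : realType) := BMSChannel {
  law : bool -> probability Y R;
  flip : Y -> Y;
  flip_measurable : measurable_fun setT flip;
  flipK : involutive flip;
  law_flip : forall B, measurable B -> law true B = law false (flip @^-1` B)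
}.

(* Y is the channel alphabet, A the message alphabet.  Each node map receives
   the messages of the other edges of the node in the order of their sockets;
   the maps need not be symmetric functions. *)
Record decoder dY dA (Y : measurableType dY) (A : measurableType dA)
    (dv dc : nat) := Decoder {
  erasure : A;
  init_map : Y -> A;
  check_map : dc.-1.-tuple A -> A;
  var_map : Y -> dv.-1.-tuple A -> A;
  represents_plus1 : set A;
  init_map_measurable : measurable_fun setT init_map;
  check_map_measurable : measurable_fun setT check_map;
  var_map_measurable :
    measurable_fun setT (fun p : Y * dv.-1.-tuple A => var_map p.1 p.2);
  represents_plus1_measurable : measurable represents_plus1;
  erasure_incorrect : ~ represents_plus1 erasure
}.

(* The edges are identified with the variable sockets: edge (v, i) leaves
   socket i of variable node v. *)
Definition edge (dv n : nat) : finType := ('I_n * 'I_dv)%type.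
Definition check_socket (dv dc n : nat) : finType :=
  ('I_(n * dv %/ dc) * 'I_dc)%type.

(* A Tanner multigraph is a bijection between variable sockets and check
   sockets, stored with its inverse. *)
Definition is_matching dv dc n
    (p : {ffun edge dv n -> check_socket dv dc n} *
         {ffun check_socket dv dc n -> edge dv n}) : bool :=
  [forall e, p.2 (p.1 e) == e] && [forall s, p.1 (p.2 s) == s].

Definition tanner (dv dc n : nat) : finType := {p | @is_matching dv dc n p}.

Definition socket_of dv dc n (g : tanner dv dc n) : edge dv n -> check_socket dv dc n :=
  (val g).1.
Definition edge_at dv dc n (g : tanner dv dc n) : check_socket dv dc n -> edge dv n :=
  (val g).2.

Section decoding.
Context dY dA (Y : measurableType dY) (A : measurableType dA) (dv dc : nat).
Variables (D : decoder Y A dv dc) (n : nat) (g : tanner dv dc n).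

Definition receive (missing : bool) (a : A) : A :=
  if missing then erasure D else a.

(* The check-to-variable message sent on e when the messages a are sent to the
   check nodes and the edges in miss are missing. *)
Definition check_message (miss : edge dv n -> bool) (a : edge dv n -> A)
    (e : edge dv n) : A :=
  let s := socket_of g e in
  check_map D [tuple let e' := edge_at g (s.1, lift s.2 k) in
                     receive (miss e') (a e') | k < dc.-1].

(* The message computed for e by its variable node in iteration t; miss t is
   the set of edges that are missing in iteration t. *)
Fixpoint var_message (miss : nat -> edge dv n -> bool) (y : n.-tuple Y)
    (t : nat) : edge dv n -> A :=
  match t with
  | 0 => fun e => init_map D (tnth y e.1)
  | t'.+1 => fun e =>
      var_map D (tnth y e.1)
        [tuple let e' := (e.1, lift e.2 k) in
               receive (miss t'.+1 e')
                 (check_message (miss t'.+1) (var_message miss y t') e')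
        | k < dv.-1]
  end.

Definition error_fraction (R : realType) (miss : nat -> edge dv n -> bool)
    (y : n.-tuple Y) (l : nat) : R :=
  #|[pred e | var_message miss y l e \notin represents_plus1 D]|%:R
  / (n * dv)%:R.

End decoding.

(* The probability of the configuration m of independent Bernoulli(alpha)
   variables indexed by I. *)
Definition bernoulli_weight (R : realType) (I : finType) (alpha : R)
    (m : {ffun I -> bool}) : R :=
  \prod_i (if m i then alpha else 1 - alpha).

(* E[P_e^(l)] at length n, when the missing edges are determined, through miss,
   by independent Bernoulli(alpha) variables indexed by I. *)
Definition mean_error (R : realType) dY dA (Y : measurableType dY)
    (A : measurableType dA) (dv dc : nat) (D : decoder Y A dv dc)
    (W : bms_channel Y R) (alpha : R) (l n : nat) (I : finType)
    (miss : {ffun I -> bool} -> nat -> edge dv n -> bool) : R :=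
  #|tanner dv dc n|%:R^-1 *
  \sum_(g : tanner dv dc n) \sum_(m : {ffun I -> bool})
    bernoulli_weight alpha m *
    fine 'E_(iid (law W false) n)[fun y => error_fraction D g R (miss m) y l].

Definition mean_error_permanent (R : realType) dY dA (Y : measurableType dY)
    (A : measurableType dA) (dv dc : nat) (D : decoder Y A dv dc)
    (W : bms_channel Y R) (alpha : R) (l n : nat) : R :=
  mean_error D W alpha l
    (fun (m : {ffun edge dv n -> bool}) (t : nat) (e : edge dv n) => m e).

(* Only iterations up to l are relevant for the messages of iteration l. *)
Definition mean_error_transient (R : realType) dY dA (Y : measurableType dY)
    (A : measurableType dA) (dv dc : nat) (D : decoder Y A dv dc)
    (W : bms_channel Y R) (alpha : R) (l n : nat) : R :=
  mean_error D W alpha l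
    (fun (m : {ffun 'I_l.+1 * edge dv n -> bool}) (t : nat) (e : edge dv n) =>
       m (inord t, e)).

(* n -> oo along the lengths n for which the ensemble exists *)
Definition length_to_oo (dv dc : nat) : set_system nat :=
  within [set n | (dc %| n * dv)%N] \oo.

(* Main.v *)
Require Import Defs.
From HB Require Import structures.
From mathcomp Require Import all_boot all_order all_algebra.
From mathcomp Require Import all_classical all_reals all_analysis.
From mathcomp Require Import perm measurable_realfun zify lra.
Set Implicit Arguments.
Unset Strict Implicit.
Unset Printing Implicit Defensive.
Import Order.TTheory GRing.Theory Num.Theory.
Import numFieldNormedType.Exports.
Local Open Scope classical_set_scope.
Local Open Scope ring_scope.

(* Unrolling the decoder expresses the message on an edge e after l iterations
   through the channel values and the missing-edge indicators met by walks from
   e of length at most 2l.  When these walks do not collide, they visit pairwise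
   distinct variable nodes and pairwise distinct edges, each edge in a single
   iteration; the indicators involved are then independent whether they are
   redrawn in every iteration or not, and the error probability of e is the same
   constant (that of a finite tree) for both models.

   A collision has probability O(1/n).  At the first one, a new edge x leads to
   a node that was already reached.  Exchanging the partner of x with that of an
   arbitrary edge y that has not been visited leaves the earlier part of the
   exploration unchanged, and the exchange can be undone from the new graph and
   a bounded amount of information; so such graphs make up a fraction O(1/n) of
   the ensemble. *)

(** * Matchings and the exchange of two edges *)

Section walks.
Local Open Scope nat_scope.
Context {dv dc n : nat}.
Implicit Types (g : tanner dv dc n) (e x y : edge dv n).

Lemma socket_ofK g : cancel (socket_of g) (edge_at g).
Proof. by move=> e; have /andP[/forallP/(_ e)/eqP] := valP g. Qed.

Lemma edge_atK g : cancel (edge_at g) (socket_of g).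
Proof. by move=> s; have /andP[_ /forallP/(_ s)/eqP] := valP g. Qed.

Lemma tanner_gt0 : dc %| n * dv -> 0 < #|tanner dv dc n|.
Proof.
move=> dvd; have E : #|edge dv n| = #|check_socket dv dc n|.
  by rewrite !card_prod !card_ord divnK.
pose p1 := [ffun x : edge dv n => enum_val (cast_ord E (enum_rank x))].
pose p2 := [ffun s : check_socket dv dc n =>
  enum_val (cast_ord (esym E) (enum_rank s))].
have mp : is_matching (p1, p2).
  apply/andP; split; apply/forallP => s /=; rewrite !ffunE enum_valK.
    by rewrite cast_ordK enum_rankK.
  by rewrite cast_ordKV enum_rankK.
by apply/card_gt0P; exists (exist _ (p1, p2) mp).
Qed.

Lemma is_matching_swap g x y : is_matching
  ([ffun e => socket_of g (tperm x y e)],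
   [ffun s : check_socket dv dc n => tperm x y (edge_at g s)]).
Proof.
apply/andP; split; apply/forallP => s /=; rewrite !ffunE.
  by rewrite socket_ofK tpermK.
by rewrite tpermK edge_atK.
Qed.

Definition swap g x y : tanner dv dc n :=
  exist (fun p => is_matching p) _ (is_matching_swap g x y).

Lemma socket_of_swap g x y e : socket_of (swap g x y) e = socket_of g (tperm x y e).
Proof. by rewrite /socket_of ffunE. Qed.

Lemma edge_at_swap g x y s : edge_at (swap g x y) s = tperm x y (edge_at g s).
Proof. by rewrite /edge_at ffunE. Qed.

Lemma swapK g x y : swap (swap g x y) x y = g.
Proof.
apply: val_inj; apply: injective_projections; apply/ffunP => s /=.
  by rewrite ffunE socket_of_swap tpermK.
by rewrite ffunE edge_at_swap tpermK.
Qed.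

(** * Walks in a Tanner graph and their collisions *)

Definition direction := ('I_dv.-1 + 'I_dc.-1)%type.
Implicit Types (a b : direction) (u v w z : seq direction).

Definition step g a e : edge dv n :=
  match a with
  | inl k => (e.1, lift e.2 k)
  | inr j => edge_at g ((socket_of g e).1, lift (socket_of g e).2 j)
  end.

(* A walk is the list of its steps, the last step first. *)
Definition walk g e w : edge dv n := foldr (step g) e w.

Definition is_inl a := if a is inl _ then true else false.

(** The first step, at the end of the list, turns at a variable node, as in the unrolling of the
    message computed there. *)
Fixpoint alternating w : bool :=
  if w is a :: u then (is_inl a == ~~ odd (size u)) && alternating u else true.

(** The start [e] is left out because the first step of an alternating walk turns at its variable
    node and does not consult its check socket. *)
Fixpoint visited g e w : seq (edge dv n) :=
  if w is _ :: u then walk g e w :: visited g e u else [::].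

Definition end_node g (check : bool) e : 'I_n + 'I_(n * dv %/ dc) :=
  if check then inr (socket_of g e).1 else inl e.1.

(** This is the node where an alternating walk turns next: a check node after an odd number of
    steps, a variable node after an even number. *)
Definition walk_node g e w := end_node g (odd (size w)) (walk g e w).

Lemma size_visited g e w : size (visited g e w) = size w.
Proof. by elim: w => //= a w ->. Qed.

Lemma visitedP g e w x : alternating w -> x \in visited g e w ->
  exists z, [/\ alternating z, z != [::], x = walk g e z, size z <= size w &
             size z = size w -> z = w].
Proof.
elim: w => // a w IH aw; rewrite in_cons => /orP[/eqP ->|xw].
  by exists (a :: w); split.
have {IH xw}[|z [az z0 -> zw _]] := IH _ xw; first by case/andP: aw.
exists z; split => //=; first exact: leqW.
by move=> E; rewrite E ltnn in zw.
Qed.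

(** A step keeps the node at which it turns, so the old and the new edge share it. *)
Lemma end_node_step g e a u : alternating (a :: u) ->
  end_node g (odd (size u)) (walk g e (a :: u)) = walk_node g e u.
Proof.
rewrite /walk_node => /= /andP[]; case: a => [k|j] /=; case: odd => //= _ _.
by rewrite /end_node /= edge_atK.
Qed.

Lemma step_inj g e a b : is_inl a = is_inl b -> step g a e = step g b e -> a = b.
Proof.
case: a b => [k|j] [k'|j'] //= _; first by move=> /(congr1 snd) /lift_inj ->.
by move=> /(can_inj (edge_atK g)) /(congr1 snd) /lift_inj ->.
Qed.

Lemma step_neq g e a : step g a e != e.
Proof.
case: a => [k|j] /=; apply/eqP.
  by move=> /(congr1 snd) /esym/eqP; rewrite (negPf (neq_lift _ _)).
move=> /(congr1 (socket_of g)); rewrite edge_atK => /(congr1 snd) /esym/eqP.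
by rewrite (negPf (neq_lift _ _)).
Qed.

(* The walks of length at most m from e explore a tree. *)
Definition collision_free g e m := forall w z, alternating w -> alternating z ->
  size w <= m -> size z <= m -> walk_node g e w = walk_node g e z -> w = z.

(** An edge reached twice is crossed either in the same direction, so that both walks come from the
    same node, or in opposite directions, so that one walk would turn straight back along its edge.
    The gain of one step over [m] drives the next induction. *)
Lemma collision_free_walk_inj g e m a b u v : collision_free g e m ->
  alternating (a :: u) -> alternating (b :: v) -> size u <= m -> size v <= m ->
  walk g e (a :: u) = walk g e (b :: v) -> a :: u = b :: v.
Proof.
move=> cf.
wlog szuv : a b u v / size v <= size u.
  move=> H au bv um vm E.
  case: (leqP (size v) (size u)) => [vu|/ltnW uv]; first exact: H.
  by apply: esym; apply: H.
move=> au bv um vm E.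
have [aau abv] : alternating u /\ alternating v by case/andP: au; case/andP: bv.
have [par|par] := boolP (odd (size u) == odd (size v)).
  have uv : u = v.
    apply: cf => //; rewrite -(end_node_step g e au) -(end_node_step g e bv).
    by rewrite (eqP par) E.
  subst v; congr (_ :: _); apply: step_inj E.
  by case/andP: au => /eqP -> _; case/andP: bv => /eqP -> _.
have vltu : size v < size u.
  by rewrite ltn_neqAle szuv andbT; apply: contraNneq par => ->.
have uv : u = b :: v.
  apply: cf => //=; first exact: leq_trans vltu um.
  rewrite -(end_node_step g e au) /walk_node E /=; congr end_node.
  by move: par; do 2 case: odd.
by have := step_neq g (walk g e u) a; rewrite -[step _ _ _]/(walk g e (a :: u)) E uv eqxx.
Qed.

(* The last edge of w is visited for the first time, and closes a cycle at the
   node reached by z. *)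
Definition closes g e w z := [&& w != [::], alternating w, alternating z,
  walk_node g e w == walk_node g e z &
  walk g e w \notin visited g e (behead w) ++ visited g e z].

(** By induction, the longer walk of a first collision has length [m.+1]. A tree of depth [m]
    already separates the edges one step further, so the last edge of this walk is new and closes a
    cycle. *)
Lemma collision_free_closes g e m :
  (forall w z, size w <= m -> size z <= m -> ~~ closes g e w z) ->
  collision_free g e m.
Proof.
elim: m => [_ [|? ?] [|? ?] //|m IH ncl].
have {}IH : collision_free g e m.
  by apply: IH => w z wm zm; apply: ncl; exact: leqW.
suff H w z : alternating w -> alternating z -> size w <= m.+1 ->
    size z <= size w -> walk_node g e w = walk_node g e z -> w = z.
  move=> w z aw az wm zm E; case: (leqP (size z) (size w)) => [zw|/ltnW wz].
    exact: H.
  by apply: esym; apply: H.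
move=> aw az wm zw E.
case: (leqP (size w) m) => [wm'|mw]; first by apply: IH => //; exact: leq_trans wm'.
have sw : size w = m.+1 by apply/eqP; rewrite eqn_leq wm.
case: w aw E zw wm mw sw => // a u aw E zw wm _ [su].
apply: contraTeq (ncl _ _ wm (leq_trans zw wm)) => nwz; rewrite negbK.
have au : alternating u by case/andP: aw.
have new t : alternating t -> t != [::] -> size t <= m.+1 ->
    walk g e (a :: u) = walk g e t -> a :: u = t.
  case: t => // b t at_ _ tm Et; exact: (collision_free_walk_inj IH).
apply/and5P; split => //; first exact/eqP.
rewrite mem_cat negb_or; apply/andP; split; apply/negP.
  move=> /(visitedP au)[t [at_ t0 Et tu _]].
  have := new t at_ t0 (leq_trans tu _) Et; rewrite su => /(_ (leqnSn _)) tE.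
  by rewrite -tE ltnn in tu.
move=> /(visitedP az)[t [at_ t0 Et tz tzE]].
have tE := new t at_ t0 (leq_trans tz (leq_trans zw wm)) Et.
(* [t] equals [a :: u] and is thus as long as [z], so the last clause of [visitedP] identifies it
   with [z]. *)
case/eqP: nwz; rewrite tE; apply: tzE; apply/eqP; rewrite eqn_leq tz.
by rewrite -tE.
Qed.

(** * Switching and the number of graphs with a collision *)

Lemma swap_walk g e w x y : alternating w ->
  x \notin visited g e w -> y \notin visited g e w ->
  walk (swap g x y) e w = walk g e w /\ visited (swap g x y) e w = visited g e w.
Proof.
elim: w => // a w IH aaw xw yw; have /andP[ia aw] := aaw.
move: xw yw; rewrite /= !in_cons !negb_or => /andP[xa xw] /andP[ya yw].
have [Ew Ev] := IH aw xw yw.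
suff E : step (swap g x y) a (walk (swap g x y) e w) = step g a (walk g e w).
  by split; [exact: E|rewrite Ev; congr (_ :: _); exact: E].
(* A variable step ignores the matching. A check step is never the first, so the edge it leaves is
   itself visited and keeps its socket. *)
rewrite Ew; case: a ia xa ya {aaw} => //= j; case: w {IH Ew Ev} aw xw yw => // b w.
move=> _ xw yw _ xa ya.
have Es : socket_of (swap g x y) (walk g e (b :: w)) = socket_of g (walk g e (b :: w)).
  rewrite socket_of_swap tpermD //.
    by apply: contraNneq xw => ->; rewrite mem_head.
  by apply: contraNneq yw => ->; rewrite mem_head.
by rewrite Es edge_at_swap tpermD // 1?eq_sym.
Qed.

(* Switching: exchanging the edge that ends w with an arbitrary unvisited edge y
   is undone from the new graph and the socket number of the old edge at the
   node where z ends. *)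
Lemma card_closes e w z :
  #|[pred g | closes g e w z]| * (n * dv - (size w + size z)) <=
  #|tanner dv dc n| * (dv + dc).
Proof.
case: w => [|a u]; first by rewrite (eq_card0 (A := [pred g | _])).
pose K g := visited g e u ++ visited g e z.
pose dom := [pred p : tanner dv dc n * edge dv n |
  closes p.1 e (a :: u) z && (p.2 \notin K p.1)].
(* Double counting: each closing graph admits at least that many [y], and [dom] injects into graphs
   paired with a socket number. *)
apply: (@leq_trans #|dom|).
  rewrite -sum_nat_const -sum1_card.
  rewrite -(pair_big_dep (fun g => closes g e (a :: u) z)
    (fun g y => y \notin K g) (fun _ _ => 1)) /=.
  apply: leq_sum => g _; rewrite sum1_card.
  have := cardC (mem (K g)); rewrite card_prod !card_ord => <-.
  rewrite leq_subLR; apply: leq_add; last exact: leqnn.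
  rewrite (leq_trans (card_size _)) // size_cat !size_visited /=.
  by rewrite leq_add2r leqnSn.
have domP p : p \in dom ->
    let x := walk p.1 e (a :: u) in let g' := swap p.1 x p.2 in
    [/\ walk g' e u = walk p.1 e u, walk g' e z = walk p.1 e z,
        x \notin visited p.1 e u & p.2 \notin visited p.1 e u] /\
    [/\ x \notin visited p.1 e z, p.2 \notin visited p.1 e z,
        alternating (a :: u), alternating z &
        walk_node p.1 e (a :: u) = walk_node p.1 e z].
  move=> /andP[/and5P[_ au az /eqP E]]; rewrite /= !mem_cat !negb_or.
  move=> /andP[xu xz] /andP[yu yz]; split; split=> //.
    by have [] := swap_walk (proj2 (andP au)) xu yu.
  by have [] := swap_walk az xz yz.
case: a @dom domP => [k|j] dom domP.
  (* Last step at a variable node: [x] still ends the walk in the new graph, and [y] now occupies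
     the old socket of [x], at the check node where [z] ends. *)
  pose f p := (swap p.1 (walk p.1 e (inl k :: u)) p.2,
               (socket_of p.1 (walk p.1 e (inl k :: u))).2).
  pose f' (q : tanner dv dc n * 'I_dc) :=
    let x := walk q.1 e (inl k :: u) in
    let y := edge_at q.1 ((socket_of q.1 (walk q.1 e z)).1, q.2) in
    (swap q.1 x y, y).
  have fK : {in dom, cancel f f'}.
    move=> [g y] /domP [[/= Eu Ez xu yu] [xz yz au az]].
    rewrite /walk_node /= => Enode; rewrite /f' /f /=.
    rewrite Eu Ez; set x := walk g e u in xu yu Enode *.
    set x' := (x.1, lift x.2 k) in xu xz Enode Eu Ez *.
    have ou : odd (size u) = false.
      by case/andP: au => /eqP /esym /negbTE.
    have [b [v zE]] : exists b v, z = b :: v.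
      case: (z) Enode => [|b v _]; last by exists b, v.
      by rewrite ou.
    have oz : odd (size z) by move: Enode; rewrite ou /end_node; case: odd.
    move: Enode; rewrite ou oz => -[Enode].
    have Es : socket_of (swap g x' y) (walk g e z) = socket_of g (walk g e z).
      have zv : walk g e z \in visited g e z by rewrite zE mem_head.
      rewrite socket_of_swap tpermD //.
        by apply: contraNneq xz => ->.
      by apply: contraNneq yz => ->.
    rewrite Es -Enode -surjective_pairing edge_at_swap socket_ofK tpermL.
    by rewrite swapK.
  rewrite -(card_in_imset (can_in_inj fK)); apply: leq_trans (max_card _) _.
  by rewrite card_prod card_ord leq_mul2l leq_addl orbT.
(* Last step at a check node: [y] now ends the walk in the new graph, and [x] is found at the
   variable node where [z] ends. *)
pose f p := (swap p.1 (walk p.1 e (inr j :: u)) p.2, (walk p.1 e (inr j :: u)).2).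
pose f' (q : tanner dv dc n * 'I_dv) :=
  let x := ((walk q.1 e z).1, q.2) in let y := walk q.1 e (inr j :: u) in
  (swap q.1 x y, y).
have fK : {in dom, cancel f f'}.
  move=> [g y] /domP [[/= Eu Ez xu yu] [xz yz au az]].
  rewrite /walk_node => Enode; rewrite /f' /f /=.
  rewrite Eu Ez; move: Enode => /=; set x := walk g e u in xu yu Eu Ez *.
  set x' := edge_at g _ in xu xz Eu Ez * => Enode.
  have ou : odd (size u) by case/andP: au => /eqP /=; case: odd.
  have uE : exists b v, u = b :: v by case: (u) ou => // b v; exists b, v.
  have oz : odd (size z) = false by move: Enode; rewrite ou /end_node; case: odd.
  move: Enode; rewrite ou oz => -[Enode].
  have Es : socket_of (swap g x' y) x = socket_of g x.
    have xv : x \in visited g e u by case: uE => b [v uE]; rewrite /x uE mem_head.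
    rewrite socket_of_swap tpermD //.
      by apply: contraNneq xu => ->.
    by apply: contraNneq yu => ->.
  rewrite Es -Enode -surjective_pairing edge_at_swap.
  by rewrite -/x' tpermL swapK.
rewrite -(card_in_imset (can_in_inj fK)); apply: leq_trans (max_card _) _.
by rewrite card_prod card_ord leq_mul2l leq_addr orbT.
Qed.

(** Union bound over the pairs of walks that may close a cycle; the number of pairs does not depend
    on [n]. *)
Lemma card_not_collision_free e m :
  #|[pred g : tanner dv dc n | `[< ~ collision_free g e m >]]| * (n * dv - (m + m)) <=
  #|{: m.-bseq direction * m.-bseq direction}| * (#|tanner dv dc n| * (dv + dc)).
Proof.
pose bad (p : m.-bseq direction * m.-bseq direction) := [pred g | closes g e p.1 p.2].
apply: (@leq_trans (\sum_p #|bad p| * (n * dv - (m + m)))).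
  rewrite -big_distrl leq_mul2r; apply/orP; right.
  rewrite -sum1_card /=.
  under [X in _ <= X]eq_bigr do rewrite -sum1_card big_mkcond.
  rewrite exchange_big big_mkcond /=; apply: leq_sum => g _.
  rewrite inE; case: asboolP => // ncf.
  have [p gp] : exists p, g \in bad p.
    apply: contra_notP ncf => ncl; apply: collision_free_closes => w z wm zm.
    by apply/negP => cl; apply: ncl; exists (Bseq wm, Bseq zm).
  by rewrite (bigD1 p) //= gp.
rewrite -sum_nat_const; apply: leq_sum => p _.
apply: leq_trans (card_closes e p.1 p.2); rewrite leq_mul2l leq_sub2l ?orbT //.
by apply: leq_add; exact: size_bseq.
Qed.

End walks.

(** * The computation tree of an edge *)

Section computation_tree.
Local Open Scope nat_scope.
Context {dv dc : nat}.

(* The variable nodes, and the edges other than the root edge, of the tree that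
   t iterations explore. *)
Fixpoint tree_node t : finType :=
  if t is t'.+1 then option ('I_dv.-1 * 'I_dc.-1 * tree_node t')%type else unit.

Fixpoint tree_edge t : finType :=
  if t is t'.+1 then ('I_dv.-1 * option ('I_dc.-1 * option (tree_edge t')))%type
  else void.

Fixpoint node_path t : tree_node t -> seq (@direction dv dc) :=
  if t is t'.+1 then fun p =>
    if p is Some (k, j, p') then rcons (rcons (node_path p') (inr j)) (inl k)
    else [::]
  else fun _ => [::].

(** The steps leading into a subtree come first, hence are appended at the end of the list. *)
Fixpoint edge_path t : tree_edge t -> seq (@direction dv dc) :=
  match t with
  | 0 => fun _ => [::]
  | t'.+1 => fun q => match q with
    | (k, None) => [:: inl k]
    | (k, Some (j, None)) => [:: inr j; inl k]
    | (k, Some (j, Some q')) => rcons (rcons (edge_path q') (inr j)) (inl k)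
    end
  end.

(** The iteration in which the edge is used: both layers of edges of one level belong to the same
    iteration, and the top level to the last one. *)
Fixpoint edge_time t : tree_edge t -> nat :=
  if t is t'.+1 then fun q =>
    if q is (_, Some (_, Some q')) then edge_time q' else t
  else fun _ => 0.

Lemma alternating_rcons2 (w : seq (@direction dv dc)) k j :
  alternating (rcons (rcons w (inr j)) (inl k)) = alternating w.
Proof. by elim: w => //= a w ->; rewrite !size_rcons /= negbK. Qed.

Lemma node_pathP t (p : tree_node t) :
  [/\ alternating (node_path p), odd (size (node_path p)) = false &
      size (node_path p) <= t + t].
Proof.
elim: t p => [|t IH] //= [[[k j] p]|] //.
have [a o s] := IH p; rewrite alternating_rcons2 !size_rcons /= negbK.
by split => //; lia.
Qed.

Lemma edge_pathP t (q : tree_edge t) :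
  [/\ alternating (edge_path q), edge_path q != [::] &
      size (edge_path q) <= t + t].
Proof.
elim: t q => [|t IH] [] //= k [[j [q|]]|] //=; try by split => //; lia.
have [a o s] := IH q; rewrite alternating_rcons2 !size_rcons.
by split => //; [rewrite -size_eq0 size_rcons | lia].
Qed.

Lemma node_path_inj t : injective (@node_path t).
Proof.
elim: t => [[] []//|t IH] /= [[[k j] p]|] [[[k' j'] p']|] //=;
  try by move=> /(congr1 size); rewrite !size_rcons.
by move=> /rcons_inj[/rcons_inj[/IH -> ->] ->].
Qed.

Lemma edge_path_inj t : injective (@edge_path t).
Proof.
have ne t' (q : tree_edge t') : edge_path q = [::] -> False.
  by have [_ /eqP] := edge_pathP q.
elim: t => [[]|t IH] /= [k [[j [q|]]|]] [k' [[j' [q'|]]|]] //=;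
  try by move=> /(congr1 size); rewrite !size_rcons.
- by move=> /rcons_inj[/rcons_inj[/IH -> ->] ->].
- by move=> /(congr1 size); rewrite !size_rcons /= => -[] /size0nil /ne.
- by move=> /(congr1 size); rewrite !size_rcons /= => -[] /esym/size0nil /ne.
- by move=> [-> ->].
- by move=> [->].
Qed.

Context dY dA (Y : measurableType dY) (A : measurableType dA).
Variable D : decoder Y A dv dc.

Fixpoint tree_message t : (tree_edge t -> bool) -> (tree_node t -> Y) -> A :=
  match t with
  | 0 => fun b z => init_map D (z tt)
  | t'.+1 => fun b z =>
      var_map D (z None)
        [tuple receive D (b (k, None))
          (check_map D [tuple receive D (b (k, Some (j, None)))
            (tree_message (fun q => b (k, Some (j, Some q)))
                          (fun p => z (Some (k, j, p)))) | j < dc.-1])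
        | k < dv.-1]
  end.

Lemma eq_tree_message t b b' (z z' : tree_node t -> Y) :
  b =1 b' -> z =1 z' -> tree_message b z = tree_message b' z'.
Proof. by move=> /funext -> /funext ->. Qed.

(** This holds in every graph: a collision only makes labels of the tree coincide. *)
Lemma var_message_tree n (g : tanner dv dc n) miss y t e :
  var_message D g miss y t e =
  tree_message (fun q : tree_edge t => miss (edge_time q) (walk g e (edge_path q)))
               (fun p => tnth y (walk g e (node_path p)).1).
Proof.
elim: t e => [//|t IH] e /=; congr var_map; apply: eq_mktuple => k.
congr receive; rewrite /check_message; congr check_map.
apply: eq_mktuple => j; congr receive; rewrite IH.
by apply: eq_tree_message => q; rewrite /walk -?cats1 !foldr_cat.
Qed.

Lemma measurable_receive d (T : measurableType d) b (f : T -> A) :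
  measurable_fun setT f -> measurable_fun setT (fun x => receive D b (f x)).
Proof. by case: b => //= _; exact: measurable_cst. Qed.

Lemma measurable_tree_message d (T : measurableType d) t b
    (z : T -> tree_node t -> Y) :
  (forall p, measurable_fun setT (z ^~ p)) ->
  measurable_fun setT (fun x => tree_message b (z x)).
Proof.
elim: t b z => [|t IH] b z mz /=.
  by apply: measurableT_comp (mz tt); exact: init_map_measurable.
apply: (measurableT_comp (var_map_measurable D)
  (g := fun x => (z x None, [tuple _ | k < dv.-1]))).
apply: measurable_fun_pair; first exact: mz.
apply/measurable_fun_tnthP => k /=.
rewrite (_ : _ \o _ = fun x => receive D (b (k, None)) (check_map D
    [tuple receive D (b (k, Some (j, None)))
            (tree_message (fun q => b (k, Some (j, Some q)))
                          (fun p => z x (Some (k, j, p)))) | j < dc.-1])).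
  apply: measurable_receive; apply: measurableT_comp.
    exact: check_map_measurable.
  apply/measurable_fun_tnthP => j /=.
  rewrite (_ : _ \o _ = fun x => receive D (b (k, Some (j, None)))
     (tree_message (fun q => b (k, Some (j, Some q)))
                          (fun p => z x (Some (k, j, p))))).
    by apply: measurable_receive; apply: IH => p; exact: mz.
  by apply/funext => x /=; rewrite tnth_mktuple.
by apply/funext => x /=; rewrite tnth_mktuple.
Qed.

End computation_tree.

(** * Marginals of product laws along an injection *)

Section marginals.

Lemma big_codom (S : Type) (idx : S) (op : Monoid.com_law idx) (I J : finType)
    (f : J -> I) (F : I -> S) : injective f ->
  (forall i, i \notin codom f -> F i = idx) ->
  \big[op/idx]_i F i = \big[op/idx]_j F (f j).
Proof.
move=> injf F1; rewrite (bigID (fun i => i \in codom f)) /= [X in op _ X]big1 //.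
rewrite Monoid.mulm1 -big_uniq /=; last by rewrite map_inj_uniq ?enum_uniq.
by rewrite /codom /image_mem big_map big_enum.
Qed.

Lemma bernoulli_weight_marginal (R : realType) (I J : finType) (alpha : R)
    (f : J -> I) (G : {ffun J -> bool} -> R) : injective f ->
  \sum_(m : {ffun I -> bool}) bernoulli_weight alpha m * G [ffun q => m (f q)] =
  \sum_(m : {ffun J -> bool}) bernoulli_weight alpha m * G m.
Proof.
move=> injf.
rewrite (partition_big (fun m : {ffun I -> bool} => [ffun q => m (f q)]) xpredT) //=.
apply: eq_bigr => m' _.
rewrite (eq_bigr (fun m => bernoulli_weight alpha m * G m')); last first.
  by move=> m /eqP ->.
rewrite -big_distrl /=; congr (_ * _).
(* [F i] is the set of values allowed at [i] in the fibre over [m']: one value on the image of [f],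
   both elsewhere. The sum over the fibre becomes a product of sums, with factor 1 off the image. *)
pose F i : pred bool := fun c => [forall q, (f q == i) ==> (c == m' q)].
rewrite (eq_bigl (fun m : {ffun I -> bool} => m \in family F)); last first.
  move=> m; apply/eqP/familyP => [E i|H].
    by apply/forallP => q; apply/implyP => /eqP <-; rewrite -E ffunE.
  apply/ffunP => q; rewrite ffunE; have /forallP/(_ q) := H (f q).
  by rewrite eqxx => /eqP.
pose c (b : bool) := if b then alpha else 1 - alpha.
rewrite -(bigA_distr_big_dep F (fun _ => c)) /=.
rewrite (big_codom _ injf) => [|i ni].
  apply: eq_bigr => q _; rewrite (big_pred1 (m' q)) // => b /=.
  apply/forallP/eqP => [/(_ q)|-> q'].
    by rewrite eqxx => /eqP.
  by apply/implyP => /eqP/injf ->.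
rewrite (eq_bigl (fun=> true)); first by rewrite big_bool /c /= addrC subrK.
move=> b; apply/forallP => q; apply/implyP => /eqP fq.
by move: ni; rewrite -fq codom_f.
Qed.

Context d (T : measurableType d) (R : realType).

Definition rectangle n (B : 'I_n -> set T) : set (n.-tuple T) :=
  [set y | forall i, B i (tnth y i)].

Lemma measurable_rectangle n (B : 'I_n -> set T) :
  (forall i, measurable (B i)) -> measurable (rectangle B).
Proof.
move=> mB; rewrite (_ : rectangle B = \big[setI/setT]_(i < n)
      ((@tnth n T ^~ i) @^-1` B i)); last first.
  apply/seteqP; split => y /=; rewrite -bigcap_seq => h i /=.
    by move=> _; exact: h.
  by apply: h; exact: mem_index_enum.
apply: bigsetI_measurable => i _; rewrite -[X in measurable X]setTI.
exact: measurable_tnth.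
Qed.

Definition reindex_tuple n N (f : 'I_N -> 'I_n) (y : n.-tuple T) : N.-tuple T :=
  [tuple tnth y (f i) | i < N].

Lemma measurable_reindex_tuple n N (f : 'I_N -> 'I_n) :
  measurable_fun setT (reindex_tuple f).
Proof.
apply/measurable_fun_tnthP => i.
rewrite (_ : _ \o _ = (fun y => tnth y (f i))); first exact: measurable_tnth.
by apply/funext => y /=; rewrite tnth_mktuple.
Qed.

HB.instance Definition _ n N (f : 'I_N -> 'I_n) :=
  isMeasurableFun.Build _ _ _ _ (reindex_tuple f) (measurable_reindex_tuple f).

(** Rectangles are stable under intersection and generate the sigma-algebra, so it suffices to
    compare the two laws on them. *)
Lemma iid_marginal (P : probability T R) n N (f : 'I_N -> 'I_n)
    (B : set (N.-tuple T)) : injective f -> measurable B ->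
  iid P n (reindex_tuple f @^-1` B) = iid P N B.
Proof.
move=> injf mB.
pose G : set (set (N.-tuple T)) :=
  [set C | exists2 B, (forall i, measurable (B i)) & C = rectangle B].
suff : distribution (iid P n) (reindex_tuple f) B = iid P N B by [].
apply: (@measure_unique _ R (N.-tuple T) G (fun=> setT)) => //.
- apply/seteqP; split; last first.
    apply: smallest_sub; first exact: sigma_algebra_measurable.
    by move=> _ [C mC ->]; exact: measurable_rectangle.
  apply: smallest_sub; first exact: smallest_sigma_algebra.
  move=> C; rewrite -bigcup_seq /= => -[i _ [C' mC' <-]].
  apply: sub_sigma_algebra.
  exists (fun j => if j == i then C' else setT).
    by move=> j; case: ifP.
  rewrite setTI; apply/seteqP; split => y /=.
    by move=> Cy j /=; case: eqP => // ->.
  by move=> /(_ i); rewrite eqxx.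
- move=> _ _ [C mC ->] [C' mC' ->]; exists (fun i => C i `&` C' i).
    by move=> i; exact: measurableI.
  apply/seteqP; split => y /=.
    by move=> [h h'] i; split; [exact: h|exact: h'].
  by move=> h; split => i; have [] := h i.
- by move=> _; exists (fun=> setT) => //; apply/seteqP; split.
- by apply/seteqP; split => // y _; exists 0%N.
- move=> _ [C mC ->].
  rewrite /distribution /pushforward /=.
  (* The preimage of a rectangle is a rectangle; coordinates off the image of [f] are unconstrained
     and contribute 1. *)
  pose C' j := if [pick i | f i == j] is Some i then C i else setT.
  have mC' j : measurable (C' j) by rewrite /C'; case: pickP.
  have C'f i : C' (f i) = C i.
    by rewrite /C'; case: pickP => [j /eqP/injf ->|/(_ i)]; rewrite ?eqxx.
  transitivity (iid P n [set y | forall j, C' j (tnth y j)]).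
    congr (iid P n _); apply/seteqP; split => y /= h.
      move=> j; rewrite /C'; case: pickP => // i /eqP <-.
      by have := h i; rewrite tnth_mktuple.
    by move=> i; rewrite tnth_mktuple -C'f.
  rewrite !iidE // (big_codom _ injf) => [|i ni].
    by apply: eq_bigr => i _; rewrite C'f.
  rewrite /C'; case: pickP => [j /eqP fj|_]; last exact: probability_setT.
  by move: ni; rewrite -fj codom_f.
- by move=> _; rewrite ltey_eq fin_num_measure.
Qed.

End marginals.

Lemma bernoulli_weight_ge0 (R : realType) (I : finType) (alpha : R)
    (m : {ffun I -> bool}) : 0 <= alpha <= 1 -> 0 <= bernoulli_weight alpha m.
Proof. by move=> ?; apply: prodr_ge0 => i _; case: ifP => _; lra. Qed.

Lemma sum_bernoulli_weight (R : realType) (I : finType) (alpha : R) :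
  \sum_(m : {ffun I -> bool}) bernoulli_weight alpha m = 1.
Proof.
rewrite -(bigA_distr_bigA (fun=> fun b : bool => if b then alpha else 1 - alpha)).
by rewrite big1 // => i _; rewrite big_bool /= addrC subrK.
Qed.

Lemma bernoulli_mean_itv (R : realType) (I : finType) (alpha : R)
    (F : {ffun I -> bool} -> R) : 0 <= alpha <= 1 -> (forall m, 0 <= F m <= 1) ->
  0 <= \sum_(m : {ffun I -> bool}) bernoulli_weight alpha m * F m <= 1.
Proof.
move=> halpha F01; apply/andP; split.
  apply: sumr_ge0 => m _; apply: mulr_ge0; first exact: bernoulli_weight_ge0.
  by case/andP: (F01 m).
rewrite -(sum_bernoulli_weight I alpha); apply: ler_sum => m _.
rewrite ler_piMr ?bernoulli_weight_ge0 //.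
by case/andP: (F01 m).
Qed.

Lemma fine_probability_itv d (T : measurableType d) (R : realType)
    (P : probability T R) (B : set T) : measurable B -> 0 <= fine (P B) <= 1.
Proof.
move=> mB; rewrite fine_ge0 //= -lee_fin fineK ?probability_le1 //.
exact: fin_num_measure.
Qed.

(** * Comparison of the mean error at length [n] with the tree *)

Section asymptotics.
Context {R : realType} {dv dc : nat} {dY dA : measure_display}.
Context {Y : measurableType dY} {A : measurableType dA}.
Variables (D : decoder Y A dv dc) (W : bms_channel Y R) (alpha : R) (l : nat).
Hypothesis halpha : 0 <= alpha <= 1.
Let P := law W false.

Definition tree_error_set (b : tree_edge l -> bool) :
    set (#|@tree_node dv dc l|.-tuple Y) :=
  [set z | ~ represents_plus1 D (tree_message D b (fun p => tnth z (enum_rank p)))].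

(** The common limit: the error probability on a tree with independent labels, free of [n] and of
    the missing-edge model. *)
Definition tree_error : R :=
  \sum_(m : {ffun tree_edge l -> bool})
    bernoulli_weight alpha m * fine (iid P _ (tree_error_set m)).

Lemma measurable_tree_error_set b : measurable (tree_error_set b).
Proof.
apply: (@measurableC _ _ (_ @^-1` represents_plus1 D)).
rewrite -[X in measurable X]setTI; apply: measurable_tree_message => //.
  by move=> p; exact: measurable_tnth.
exact: represents_plus1_measurable.
Qed.

Section fixed_length.
Variables (n : nat) (I : finType) (miss : {ffun I -> bool} -> nat -> edge dv n -> bool).

Definition error_set (g : tanner dv dc n) m e : set (n.-tuple Y) :=
  [set y | ~ represents_plus1 D (var_message D g (miss m) y l e)].

Lemma error_setE g m e : error_set g m e =
  reindex_tuple (fun i => (walk g e (node_path (enum_val i))).1) @^-1`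
    tree_error_set (fun q : tree_edge l =>
      miss m (edge_time q) (walk g e (edge_path q))).
Proof.
apply/funext => y; rewrite /error_set /tree_error_set /preimage /mkset.
congr (~ represents_plus1 D _); rewrite var_message_tree.
by apply: eq_tree_message => // p; rewrite tnth_mktuple enum_rankK.
Qed.

Lemma measurable_error_set g m e : measurable (error_set g m e).
Proof.
rewrite error_setE -[X in measurable X]setTI.
by apply: measurable_reindex_tuple => //; exact: measurable_tree_error_set.
Qed.

Definition edge_error g e : R :=
  \sum_m bernoulli_weight alpha m * fine (iid P n (error_set g m e)).

Lemma expectation_error_fraction g m :
  fine 'E_(iid P n)[fun y => error_fraction D g R (miss m) y l] =
  (n * dv)%:R^-1 * \sum_e fine (iid P n (error_set g m e)).
Proof.
have fE y : error_fraction D g R (miss m) y l =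
    \sum_e (n * dv)%:R^-1 * \1_(error_set g m e) y.
  rewrite /error_fraction mulrC -big_distrr /= -sum1_card natr_sum big_mkcond.
  congr (_ * _); apply: eq_bigr => e _.
  rewrite indicE inE.
  suff -> : (y \in error_set g m e) =
    (var_message D g (miss m) y l e \notin represents_plus1 D) by case: ifP.
  by apply/idP/idP; rewrite notin_setE in_setE.
rewrite unlock.
transitivity (fine (\int[iid P n]_y
    (\sum_e ((n * dv)%:R^-1%:E * (\1_(error_set g m e) y)%:E)))%E).
  congr fine; apply: eq_integral => y _; rewrite fE -sumEFin.
  by apply: eq_bigr => e _.
have mI e : measurable_fun setT (fun y => (\1_(error_set g m e) y)%:E : \bar R).
  by apply/measurable_EFinP; apply: measurable_indic; exact: measurable_error_set.
rewrite ge0_integral_sum // => [|e]; last exact: measurable_funeM.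
have iE e : (\int[iid P n]_y ((n * dv)%:R^-1%:E * (\1_(error_set g m e) y)%:E))%E =
    ((n * dv)%:R^-1 * fine (iid P n (error_set g m e)))%:E.
  rewrite ge0_integralZl //.
  rewrite integral_indic ?setIT //; last exact: measurable_error_set.
  rewrite EFinM fineK // fin_num_measure //; exact: measurable_error_set.
by under eq_bigr do rewrite iE; rewrite sumEFin -big_distrr.
Qed.

Lemma mean_errorE : mean_error D W alpha l miss =
  #|tanner dv dc n|%:R^-1 * \sum_g ((n * dv)%:R^-1 * \sum_e edge_error g e).
Proof.
rewrite /mean_error; congr (_ * _); apply: eq_bigr => g _.
rewrite exchange_big /= big_distrr /=; apply: eq_bigr => m _.
by rewrite expectation_error_fraction mulrCA big_distrr.
Qed.

Lemma edge_error_itv g e : 0 <= edge_error g e <= 1.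
Proof.
apply: bernoulli_mean_itv => // m; apply: fine_probability_itv.
exact: measurable_error_set.
Qed.

Lemma tree_error_itv : 0 <= tree_error <= 1.
Proof.
apply: bernoulli_mean_itv => // m; apply: fine_probability_itv.
exact: measurable_tree_error_set.
Qed.

(** [var t e] is the indicator consulted for [e] in iteration [t]. Distinct edges must not share an
    indicator, but one edge may reuse its own over time, so both models fit. *)
Variable var : nat -> edge dv n -> I.
Hypothesis var_inj : forall t t' e e', var t e = var t' e' -> e = e'.
Hypothesis missE : forall m t e, miss m t e = m (var t e).

Lemma edge_error_collision_free g e : collision_free g e (l + l) ->
  edge_error g e = tree_error.
Proof.
move=> cf.
pose h (q : tree_edge l) := var (edge_time q) (walk g e (edge_path q)).
have h_inj : injective h.
  move=> q q' /var_inj E; apply: edge_path_inj.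
  have [aq nq sq] := edge_pathP q; have [aq' nq' sq'] := edge_pathP q'.
  move: E aq nq sq aq' nq' sq'; case: (edge_path q) => [//|a u].
  case: (edge_path q') => [//|b v] E aq _ sq aq' _ sq'.
  by apply: (collision_free_walk_inj cf) => //; exact: ltnW.
rewrite /edge_error /tree_error -(bernoulli_weight_marginal _ _ h_inj).
apply: eq_bigr => m _; congr (_ * fine _); rewrite error_setE.
rewrite iid_marginal; last exact: measurable_tree_error_set.
  congr (iid _ _ (tree_error_set _)); apply/funext => q.
  by rewrite missE ffunE.
(* Node paths have even length, so their [walk_node] is a variable node and equality there is a
   collision. *)
move=> i j ij; apply/enum_val_inj/node_path_inj.
have [ai oi si] := node_pathP (enum_val i).
have [aj oj sj] := node_pathP (enum_val j).
by apply: cf => //; rewrite /walk_node oi oj /end_node ij.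
Qed.

Lemma mean_error_tree_error : (0 < #|tanner dv dc n|)%N -> (l + l + (l + l) < n * dv)%N ->
  `|mean_error D W alpha l miss - tree_error| <=
  (#|{: (l + l).-bseq (@direction dv dc) * (l + l).-bseq (@direction dv dc)}|
     * (dv + dc))%:R / (n * dv - (l + l + (l + l)))%:R.
Proof.
move=> T0 ln; set M := (#|_| * _)%N.
set N := (n * dv)%N; set T := #|tanner dv dc n| in T0 *.
have N0 : 0 < N%:R :> R by rewrite ltr0n; apply: leq_ltn_trans ln.
have TR0 : 0 < T%:R :> R by rewrite ltr0n.
have NlR0 : 0 < (N - (l + l + (l + l)))%:R :> R by rewrite ltr0n subn_gt0.
pose bad (g : tanner dv dc n) (e : edge dv n) : R :=
  `[< ~ collision_free g e (l + l) >]%:R.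
have bad_sum e : \sum_g bad g e <= T%:R * (M%:R / (N - (l + l + (l + l)))%:R).
  rewrite mulrA ler_pdivlMr // -natrM /bad -natr_sum -natrM ler_nat.
  have := card_not_collision_free (dc := dc) e (l + l).
  rewrite -/N -/T mulnCA -/M; apply: leq_trans.
  rewrite leq_mul2r -sum1_card [X in (_ <= X)%N]big_mkcond /=; apply/orP; right.
  by apply: leq_sum => g _; rewrite inE; case: asboolP.
have -> : mean_error D W alpha l miss - tree_error =
    T%:R^-1 * \sum_g (N%:R^-1 * \sum_e (edge_error g e - tree_error)).
  under [in RHS]eq_bigr => g _.
    rewrite sumrB sumr_const card_prod !card_ord -/N mulrBr -[X in _ - _ * X]mulr_natl.
    rewrite mulKf ?gt_eqF //.
    over.
  by rewrite mean_errorE sumrB sumr_const mulrBr -[X in _ - _ * X]mulr_natl mulKf ?gt_eqF.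
(* A bad edge contributes at most 1, since both errors lie in [0, 1]; any other edge contributes
   0. *)
apply: (@le_trans _ _ (T%:R^-1 * \sum_g (N%:R^-1 * \sum_e bad g e))).
  rewrite normrM ger0_norm ?invr_ge0 ?ler0n // ler_wpM2l ?invr_ge0 ?ler0n //.
  apply: le_trans (ler_norm_sum _ _ _) _; apply: ler_sum => g _.
  rewrite normrM ger0_norm ?invr_ge0 ?ler0n // ler_wpM2l ?invr_ge0 ?ler0n //.
  apply: le_trans (ler_norm_sum _ _ _) _; apply: ler_sum => e _.
  rewrite /bad; case: asboolP => [_|/contrapT cf].
    have := edge_error_itv g e; have := tree_error_itv.
    by rewrite /= ler_norml; lra.
  by rewrite edge_error_collision_free // subrr normr0.
(* Summing over graphs first lets [bad_sum] apply to each edge. *)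
rewrite -big_distrr /= exchange_big /= mulrCA.
rewrite -ler_pdivlMl ?invr_gt0 // invrK -ler_pdivlMl ?invr_gt0 // invrK.
apply: le_trans (ler_sum _ (fun e _ => bad_sum e)) _.
rewrite sumr_const card_prod !card_ord -/N -[X in X <= _]mulr_natl.
by rewrite mulrCA.
Qed.

End fixed_length.
End asymptotics.

(** * Passage to the limit along admissible lengths *)

Lemma length_to_oo_proper (dv dc : nat) : (0 < dc)%N ->
  ProperFilter (length_to_oo dv dc).
Proof.
move=> hdc; apply: Build_ProperFilter_ex => S [k _ Sk].
(* Multiples of [dc] are admissible lengths. *)
exists (dc * k)%N; apply: Sk; last by rewrite /= -mulnA dvdn_mulr.
by rewrite /= leq_pmull.
Qed.

Lemma length_to_oo_cvg (R : realType) (dv dc : nat) (u : nat -> R) (p : R)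
    (C a : nat) : (0 < dv)%N ->
  (forall n, (dc %| n * dv)%N -> (a < n * dv)%N ->
    `|u n - p| <= C%:R / (n * dv - a)%:R) ->
  u n @[n --> length_to_oo dv dc] --> p.
Proof.
move=> hdv up; apply/cvgrPdist_le => e e0.
(* From [m] on, [n * dv - a] exceeds [C / e]. *)
pose m := (a + (Num.truncn (C%:R / e)).+1)%N.
exists m => // n /= mn dvd.
have an : (m <= n * dv)%N by rewrite (leq_trans mn) // leq_pmulr.
have an' : (a < n * dv)%N by rewrite (leq_trans _ an) // /m addnS ltnS leq_addr.
rewrite distrC (le_trans (up n dvd an')) //.
rewrite ler_pdivrMr ?ltr0n ?subn_gt0 // mulrC -ler_pdivrMr //.
apply: (@le_trans _ _ (Num.truncn (C%:R / e)).+1%:R).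
  by rewrite ltW // truncnS_gt.
by rewrite ler_nat leq_subRL // ltnW.
Qed.

Theorem theorem4 (R : realType) (dv dc : nat) (hdv : (2 <= dv)%N)
    (hdc : (2 <= dc)%N) (dY dA : measure_display) (Y : measurableType dY)
    (A : measurableType dA) (D : decoder Y A dv dc)
    (W : R -> bms_channel Y R) (eps alpha : R) (halpha : 0 <= alpha <= 1)
    (l : nat) (dO : measure_display) (Omega : measurableType dO)
    (Pr : probability Omega R) (delta sigma : R) (hdelta : 0 < delta)
    (hsigma : 0 < sigma) :
  let u_T := fun n : nat => mean_error_transient D (W eps) alpha l n in
  let u_P := fun n : nat => mean_error_permanent D (W eps) alpha l n in
  let P_T := lim (u_T n @[n --> length_to_oo dv dc]) in
  let P_P := lim (u_P n @[n --> length_to_oo dv dc]) in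
  [/\ cvg (u_T n @[n --> length_to_oo dv dc]),
      cvg (u_P n @[n --> length_to_oo dv dc]) &
      (Pr [set _ | (sigma <= `|P_T - P_P|)%R] <= delta%:E)%E].
Proof.
move=> u_T u_P P_T P_P.
have dv0 : (0 < dv)%N by exact: ltnW.
have dc0 : (0 < dc)%N by exact: ltnW.
pose p := tree_error D (W eps) alpha l.
have cT : u_T n @[n --> length_to_oo dv dc] --> p.
  apply: length_to_oo_cvg => // n dvd ln.
  (* Transient case: the indicator is indexed by iteration and edge, and its second component
     recovers the edge. *)
  apply: (mean_error_tree_error D (W eps) halpha (var := fun t e => (inord t, e))) ln
    => //.
    by move=> ? ? ? ? [].
  exact: tanner_gt0.
have cP : u_P n @[n --> length_to_oo dv dc] --> p.
  apply: length_to_oo_cvg => // n dvd ln.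
  apply: (mean_error_tree_error D (W eps) halpha (var := fun t e => e)) ln => //.
  exact: tanner_gt0.
have F := length_to_oo_proper dv dc0.
have -> : P_T = P_P by rewrite /P_T /P_P (cvg_lim _ cT) // (cvg_lim _ cP).
split; [by apply/cvg_ex; exists p|by apply/cvg_ex; exists p|].
(* The limits agree, so the event asks for [sigma <= 0] and is empty. *)
rewrite subrr normr0 [X in Pr X](_ : _ = set0).
  by rewrite measure0 lee_fin ltW.
by apply/seteqP; split => // w /=; rewrite leNgt hsigma.
Qed.
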